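(* Let $\alpha>1$. The Bergman kernel $\mathcal K_\alpha$ of $\mathcal B^2_\alpha$ satisfies the integral Hörmander condition for $\sigma_\alpha$: $$\sup_{v\in\mathfrak X}\ \sup_{x,y\in U_v}\ \sum_{z\in\mathfrak X\setminus U_v}|\mathcal K_\alpha(z,x)-\mathcal K_\alpha(z,y)|\,\sigma_\alpha(z)<+\infty .$$
   Context: Let $q\ge 2$ be an integer and let $\mathfrak X$ be (the vertex set of) the $q$-homogeneous tree: the connected graph without cycles in which every vertex has exactly $q+1$ neighbours ($x\sim y$ means $x,y$ are neighbours); $d$ is the edge-counting distance, $\mathbb N=\{0,1,2,\dots\}$. An infinite chain is a sequence $(x_i)_{i\in\mathbb N}$ with $x_i\sim x_{i+1}$ and $x_i\ne x_{i+2}$; two infinite chains $(x_i),(y_j)$ are equivalent if for some $m\in\mathbb Z$ one has $x_i=y_{i+m}$ eventually; a boundary point is an equivalence class. Fix a boundary point $\omega$. For $x\in\mathfrak X$, $[x,\omega)$ is the infinite chain starting at $x$ in the class $\omega$ and $x\wedge y$ is the vertex $z$ with $[x,\omega)\cap[y,\omega)=[z,\omega)$. Vertices $x,y$ lie on the same horocycle if $d(x,x\wedge y)=d(y,x\wedge y)$. Fix a horocycle $H_0$ and, for $k\in\mathbb Z$, let $H_k=\{x: d(x,x\wedge y)=d(y,x\wedge y)+k \text{ for some } y\in H_0\}$; the $H_k$ partition $\mathfrak X$. The horocyclic index $h(x)$ is the integer with $x\in H_{h(x)}$. $U_x=\{y:[x,\omega)\subseteq[y,\omega)\}$ is the sector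 generated by $x$. $f:\mathfrak X\to\mathbb C$ is harmonic if $f(x)=\frac1{q+1}\sum_{y\sim x}f(y)$ for all $x\in\mathfrak X$. For $\alpha>1$, $\sigma_\alpha(x)=q^{-\alpha h(x)}$, and $\mathcal B^2_\alpha$ is the Hilbert space of harmonic $f:\mathfrak X\to\mathbb C$ with $\sum_{x}|f(x)|^2\sigma_\alpha(x)<\infty$, with inner product $\langle f,g\rangle=\sum_x f(x)\overline{g(x)}\sigma_\alpha(x)$. Point evaluations are continuous on $\mathcal B^2_\alpha$; for $v\in\mathfrak X$, $\mathcal K_{\alpha,v}$ is the unique element of $\mathcal B^2_\alpha$ with $f(v)=\langle f,\mathcal K_{\alpha,v}\rangle$ for all $f\in\mathcal B^2_\alpha$, and the Bergman (reproducing) kernel is $\mathcal K_\alpha(v,x)=\mathcal K_{\alpha,v}(x)$. *)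

(* Defs.v *)
From HB Require Import structures.
From mathcomp Require Import all_boot all_order all_algebra.
From mathcomp Require Import all_classical all_reals all_analysis.
From mathcomp Require Import complex.

Set Implicit Arguments.
Unset Strict Implicit.
Unset Printing Implicit Defensive.

Import Order.TTheory GRing.Theory Num.Theory.
Import numFieldNormedType.Exports.

Local Open Scope classical_set_scope.
Local Open Scope ring_scope.
Local Open Scope complex_scope.

Record homogeneous_tree (q : nat) := HomogeneousTree {
  vertex :> choiceType;
  adj : rel vertex;
  adj_sym : symmetric adj;
  adj_irr : irreflexive adj;
  adj_connected : forall x y, exists2 p, path adj x p & last x p = y;
  (* the closed walks [:: x] and [:: x; y] are not cycles of a graph *)
  adj_acyclic : forall c : seq vertex, (2 < size c)%N -> ~ ucycle adj c;
  adj_degree : forall x, ([set y | adj x y] #= `I_q.+1)%card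
}.

Section Tree.
Variables (q : nat) (X : homogeneous_tree q).
Implicit Types (x y z : X) (c : nat -> X) (w : set (nat -> X)) (H : set X).

Definition joined_by_walk x y (n : nat) : bool :=
  `[< exists p : seq X, [/\ path (@adj q X) x p, last x p = y & size p = n] >].

Fact joined_by_walk_ex x y : exists n, joined_by_walk x y n.
Proof.
have [p xp py] := adj_connected x y.
by exists (size p); apply/asboolP; exists p.
Qed.

Definition dist x y : nat := ex_minn (joined_by_walk_ex x y).

Definition infinite_chain c :=
  forall i, adj (c i) (c i.+1) /\ c i <> c i.+2.

(* i + m is a natural number for all large i, so the absolute value plays no
   role in the eventual equality. *)
Definition chain_equiv c c' :=
  exists m : int, \forall i \near \oo, c i = c' (absz (i%:Z + m)).

Definition is_boundary_point w :=
  exists2 c, infinite_chain c &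
    w = [set c' | infinite_chain c' /\ chain_equiv c c'].

(* The default values of xget, here and in meet and hindex, are irrelevant: for
   a boundary point w and a horocycle H the set under xget is a singleton. *)
Definition ray w x : nat -> X := xget (fun=> x) [set c | w c /\ c 0%N = x].

Definition meet w x y : X :=
  xget x [set z | range (ray w x) `&` range (ray w y) = range (ray w z)].

Definition same_horocycle w x y :=
  dist x (meet w x y) = dist y (meet w x y).

Definition is_horocycle w H := exists x, H = [set y | same_horocycle w x y].

Definition horocycle w H (k : int) : set X :=
  [set x | exists2 y, H y &
    (dist x (meet w x y))%:Z = (dist y (meet w x y))%:Z + k].

Definition hindex w H x : int := xget 0 [set k | horocycle w H k x].

Definition sector w x : set X :=
  [set y | range (ray w x) `<=` range (ray w y)].

End Tree.

Section UnconditionalSum.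
Variables (R : realType) (T : choiceType).

(* For absolutely summable families, these are the sums over all of T; the
   values on other families are meaningless. *)
Definition rsum (g : T -> R) : R :=
  fine (\esum_(x in [set: T]) (Num.max (g x) 0)%:E) -
  fine (\esum_(x in [set: T]) (Num.max (- g x) 0)%:E).

Definition csum (g : T -> R[i]) : R[i] :=
  rsum (fun x => complex.Re (g x)) +i* rsum (fun x => complex.Im (g x)).

End UnconditionalSum.

Section Bergman.
Variables (R : realType) (q : nat) (X : homogeneous_tree q).
Variables (w : set (nat -> X)) (H : set X) (alpha : R).
Implicit Types f g : X -> R[i].

Definition harmonic f :=
  forall x, f x = (q.+1%:R)^-1 * \sum_(y \in [set y | adj x y]) f y.

Definition sigma (x : X) : R := q%:R `^ (- (alpha * (hindex w H x)%:~R)).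

(* Normc.normc is the modulus with values in R rather than in R[i]. *)
Definition bergman_space : set (X -> R[i]) :=
  [set f | harmonic f /\
    (\esum_(x in [set: X]) (Normc.normc (f x) ^+ 2 * sigma x)%:E < +oo)%E].

(* On bergman_space the family is absolutely summable, by Cauchy-Schwarz. *)
Definition bergman_inner f g : R[i] :=
  csum (fun x => f x * (g x)^* * (sigma x)%:C).

Definition reproduces (v : X) (k : X -> R[i]) :=
  bergman_space k /\ forall f, bergman_space f -> f v = bergman_inner f k.

(* The function reproducing at v exists and is unique for 1 < alpha. *)
Definition bergman_kernel (v : X) : X -> R[i] :=
  xget (fun=> 0) [set k | reproduces v k].

End Bergman.

(* Main.v *)
Require Import Defs.
From mathcomp Require Import all_boot all_order all_algebra.
From mathcomp Require Import all_classical all_reals all_analysis.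
From mathcomp Require Import finmap complex zify ring lra.

Set Implicit Arguments.
Unset Strict Implicit.
Unset Printing Implicit Defensive.

Import Order.TTheory GRing.Theory Num.Theory.
Import numFieldNormedType.Exports.

Local Open Scope classical_set_scope.
Local Open Scope ring_scope.
Local Open Scope complex_scope.

(** The boundary point makes the tree a family tree: the parent of x is the next
    vertex of its ray, a sector is a set of descendants, the horocyclic index
    drops by one from a vertex to its parent, and sigma is multiplied by
    rho = q ^ (- alpha) from a parent to a child. As alpha > 1, q * rho < 1, so
    the weights of the sector of u sum to a multiple of sigma u
    (sum_weight_sector).

    Let c and c' be siblings with parent u. There is a bounded real harmonic
    function carried by the sector of u, with values f(n) on the descendants of
    c and - f(n) on those of c', n generations below u, where f(n) = 1 -
    q ^ (- n), and 0 elsewhere (sibling_potential). Its inner product with a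
    harmonic a only involves the sums of a over the generations below c and c'.
    By harmonicity the difference of these sums is a positive multiple of
    a c - a c', so the inner product is a c - a c' times a factor bounded below
    by a multiple of sigma u (sibling_estimate). Now let a be the real or
    imaginary part of the kernel at z: the reproducing property says that the
    inner product is, up to sign, 0 or the value of the potential at z. Hence
    |a c - a c'| is at most a multiple of 1 / sigma u, and is 0 when z is
    outside the sector of u.

    Let z be outside the sector of v. Inside that sector the kernel at z does
    not distinguish siblings, so it depends on the generation only; its
    increments are divided by q at each generation, and its oscillation is at
    most twice the increment from the parent of v to v (oscillation_sector).
    Moving up from v instead, the increment at a vertex is the increment at its
    parent divided by q, up to sibling differences (increment_step). Therefore
    the increment at v is bounded by the sum over j of q ^ (- j) times the bound
    1 / sigma u for the ancestor u of v that is j + 1 generations above, where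
    only those u count whose sector contains z (increment_bound). Summing over
    z with weight sigma z, each ancestor contributes at most a constant times
    q ^ (- j), and the total does not depend on v (sum_oscillation_le). *)

(** * Walks without backtracking *)

Section Walks.
Variables (q : nat) (X : homogeneous_tree q).

Lemma path_map_iota (s : nat -> X) i n :
  (forall k, (k < n)%N -> adj (s (i + k)%N) (s (i + k.+1)%N)) ->
  path (@adj q X) (s i) (map s (iota i.+1 n)).
Proof.
elim: n i => [//|n IH] i sE /=.
have := sE 0%N isT; rewrite addn0 addn1 => -> /=.
by apply: IH => k kn; have := sE k.+1 kn; rewrite !addSnnS.
Qed.

(** A shortest return to a vertex already visited would be a cycle of the
    tree: it has at least three vertices because the walk never backtracks. *)
Lemma walk_inj (s : nat -> X) L :
  (forall i, (i < L)%N -> adj (s i) (s i.+1)) ->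
  (forall i, (i.+1 < L)%N -> s i <> s i.+2) ->
  forall i j, (i < j <= L)%N -> s i <> s j.
Proof.
move=> sE sB.
suff H d : forall i, (i + d.+1 <= L)%N -> s i <> s (i + d.+1)%N.
  move=> i j /andP[ij jL]; have -> : j = (i + (j - i).-1.+1)%N by lia.
  by apply: H; lia.
elim/ltn_ind: d => d IH i iL sij.
case: d IH iL sij => [|[|d]] IH iL sij.
- by have := sE i ltac:(lia); rewrite sij addn1 adj_irr.
- by apply: (sB i); [lia|rewrite sij; congr s; lia].
apply: (@adj_acyclic q X (s i :: map s (iota i.+1 d.+2))).
  by rewrite /= size_map size_iota.
apply/andP; split; last first.
  rewrite -[s i :: _]/(map s (iota i d.+3)) map_inj_in_uniq ?iota_uniq//.
  move=> a b; rewrite !mem_iota => /andP[a1 a2] /andP[b1 b2] sab.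
  wlog ab : a b a1 a2 b1 b2 sab / (a < b)%N.
    move=> W; have [/W|/W|//] := ltngtP a b; [exact|by move=> W'; rewrite W'].
  have := IH (b - a).-1 ltac:(lia) a ltac:(lia).
  by have -> : (a + (b - a).-1.+1)%N = b by lia.
rewrite /cycle.
have -> : rcons (map s (iota i.+1 d.+2)) (s i) = map s (iota i.+1 d.+3).
  have -> : s i = s (i.+1 + d.+2)%N by rewrite sij; congr s; lia.
  by rewrite -[in RHS](addn1 d.+2) iotaD map_cat cats1.
apply: path_map_iota => k kd; rewrite addnS; apply: sE; lia.
Qed.

End Walks.

(** * Rays, parents and levels *)

Section Rays.
Variables (q : nat) (X : homogeneous_tree q).
Variables (w : set (nat -> X)) (hw : is_boundary_point w).
Implicit Types (x y z : X) (c : nat -> X).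

Lemma chain_equivP c c' :
  chain_equiv c c' <-> exists a b, forall i, c (a + i)%N = c' (b + i)%N.
Proof.
split=> [[m [N _ NE]]|[a [b abE]]].
  (* with a := N + |m|, the shifted index a + m is nonnegative *)
  exists (N + absz m)%N, (absz ((N + absz m)%:Z + m)) => i.
  by rewrite NE /=; [congr c'; lia|rewrite -addnA leq_addr].
exists (b%:Z - a%:Z); exists a => // i /= ai.
by rewrite -{1}(subnKC ai) abE; congr c'; lia.
Qed.

Lemma boundary_chain c : w c -> infinite_chain c.
Proof. by move: hw => [c0 _ ->] []. Qed.

Lemma boundary_eventually c c' : w c -> w c' ->
  exists a b, forall i, c (a + i)%N = c' (b + i)%N.
Proof.
move: hw => [c0 _ ->] [_ /chain_equivP[a [b E]]] [_ /chain_equivP[a' [b' E']]].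
exists (b + a')%N, (b' + a)%N => i.
by rewrite -!addnA -E -E'; congr c0; lia.
Qed.

Lemma boundary_eventually_in c c' : infinite_chain c' -> w c ->
  (exists a b, forall i, c (a + i)%N = c' (b + i)%N) -> w c'.
Proof.
move: hw => [c0 _ ->] ic' [_ /chain_equivP[a [b E]]] [a' [b' E']].
split=> //; apply/chain_equivP; exists (a + a')%N, (b' + b)%N => i.
by rewrite -!addnA E -E'; congr c; lia.
Qed.

Lemma boundary_shift c : w c -> w (c \o S).
Proof.
move=> wc; apply: (boundary_eventually_in _ wc).
  by move=> i; have := boundary_chain wc i.+1.
by exists 1%N, 0%N.
Qed.

Lemma boundary_cons c y : w c -> adj y (c 0%N) -> y <> c 1%N ->
  w (fun i => if i is j.+1 then c j else y).
Proof.
move=> wc yc0 yc1; apply: (boundary_eventually_in _ wc).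
  by case=> [//|i]; have := boundary_chain wc i.
by exists 0%N, 1%N.
Qed.

(** Two chains from the same vertex that parted would meet again, since they end
    at the same boundary point; going back along one and forth along the other
    would be a walk without backtracking from a vertex to itself. *)
Lemma boundary_inj c c' : w c -> w c' -> c 0%N = c' 0%N -> c =1 c'.
Proof.
move=> wc wc' c0; elim=> [//|k ck]; apply: contrapT => ck1.
have [a [b E]] := boundary_eventually wc wc'.
have [cE cE'] := (boundary_chain wc, boundary_chain wc').
(* s descends c from index k + n to index k, then ascends c'; it starts at
   c (a + k.+1) and ends at c' (b + k.+1), which are the same vertex *)
pose n := a.+1.
pose s i := if (i < n)%N then c (k + n - i)%N else c' (k + (i - n))%N.
have /walk_inj W : forall i, (i < n + b.+1)%N -> adj (s i) (s i.+1).
  move=> i iL; rewrite /s; case: ltnP => ain; case: ltnP => ain'; try lia.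
  - by rewrite adj_sym; have [+ _] := cE (k + n - i.+1)%N;
      congr (adj _ (c _)); lia.
  - have -> : (i.+1 - n = 0)%N by lia.
    rewrite addn0 -ck adj_sym; have [+ _] := cE k.
    by congr (adj _ (c _)); lia.
  - have [+ _] := cE' (k + (i - n))%N.
    by congr (adj _ (c' _)); lia.
apply: (W _ 0%N (n + b.+1)%N); last 2 first.
- by rewrite leqnn /n; lia.
- rewrite /s /=; case: ltnP => [|_]; first lia.
  have -> : (k + n - 0 = a + k.+1)%N by rewrite /n; lia.
  by rewrite E; congr c'; lia.
move=> i iL; rewrite /s.
case: ltnP => h1; case: ltnP => h2; try lia.
- have [_ +] := cE (k + n - i.+2)%N => /nesym.
  by have -> : ((k + n - i.+2).+2 = k + n - i)%N by lia.
- have [in1|in1] := eqVneq i.+1 n.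
    have -> : (k + n - i = k.+1)%N by lia.
    by have -> : (k + (i.+2 - n) = k.+1)%N by lia.
  have -> : (k + n - i = k.+2)%N by lia.
  have -> : (k + (i.+2 - n) = k)%N by lia.
  by rewrite -ck => /esym; have [_] := cE k.
- have [_ +] := cE' (k + (i - n))%N.
  by have -> : ((k + (i - n)).+2 = k + (i.+2 - n))%N by lia.
Qed.

Lemma boundary_neq0 : exists c, w c.
Proof.
have [c0 ic0 ->] := hw; exists c0; split=> //.
by apply/chain_equivP; exists 0%N, 0%N.
Qed.

(** A chain of w can be moved to a neighbouring starting point, by dropping its
    first vertex or by adding one, hence to any starting point. *)
Lemma boundary_ex x : exists2 c, w c & c 0%N = x.
Proof.
have [c0 wc0] := boundary_neq0.
have [p] := adj_connected (c0 0%N) x.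
elim: p c0 wc0 => [|y p IH] c wc /=; first by move=> _ <-; exists c.
move=> /andP[cy yp] px.
have [c' wc' c'y] : exists2 c', w c' & c' 0%N = y.
  have [->|yc1] := pselect (y = c 1%N).
    by exists (c \o S) => //; exact: boundary_shift.
  by eexists; [apply: (boundary_cons wc _ yc1); rewrite adj_sym|].
by apply: (IH c' wc'); rewrite c'y.
Qed.

Lemma ray_in x : w (ray w x) /\ ray w x 0%N = x.
Proof.
have [c wc cx] := boundary_ex x.
have ex : exists c, [set c | w c /\ c 0%N = x] c by exists c.
exact: (xgetPex (fun=> x) ex).
Qed.

Definition parent x : X := ray w x 1%N.

Lemma rayE x n : ray w x n = iter n parent x.
Proof.
elim: n x => [|n IH] x; first by have [] := ray_in x.
rewrite iterSr -IH.
have [wx x0] := ray_in x; have [wpx px0] := ray_in (parent x).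
by rewrite (boundary_inj wpx (boundary_shift wx)).
Qed.

Lemma adj_parent x : adj x (parent x).
Proof.
have [wx x0] := ray_in x; rewrite /parent -{1}x0.
by have [] := boundary_chain wx 0.
Qed.

Lemma parent_parent x : parent (parent x) <> x.
Proof.
have [wx x0] := ray_in x; rewrite -[LHS](rayE x 2) -{2}x0 => /esym.
by have [] := boundary_chain wx 0.
Qed.

Lemma adjP x y : adj x y = (y == parent x) || (parent y == x).
Proof.
apply/idP/orP => [xy|[/eqP->|/eqP<-]]; last 2 first.
- exact: adj_parent.
- by rewrite adj_sym adj_parent.
have [->|/eqP yx] := eqVneq y (parent x); [by left|right].
have [wx x0] := ray_in x; have [wy y0] := ray_in y.
have yx0 : adj y (ray w x 0) by rewrite adj_sym x0.
have wc := boundary_cons wx yx0 yx.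
by rewrite /parent (boundary_inj wy wc)// x0.
Qed.

Lemma iter_parent_inj x m n : iter m parent x = iter n parent x -> m = n.
Proof.
have [wx _] := ray_in x.
have inj i j : (i < j)%N -> iter i parent x <> iter j parent x.
  move=> ij; rewrite -!rayE.
  apply: (@walk_inj _ _ (ray w x) j); rewrite ?ij ?leqnn// => k _;
    by have [] := boundary_chain wx k.
by move=> mn; case: (ltngtP m n) => // /inj; rewrite mn.
Qed.

Lemma iter_parent_meet x y : exists m n, iter m parent x = iter n parent y.
Proof.
have [wx _] := ray_in x; have [wy _] := ray_in y.
have [a [b /(_ 0%N)]] := boundary_eventually wx wy.
by rewrite !rayE !addn0 => ?; exists a, b.
Qed.

(** A level function exists because any two rays merge, after numbers of steps
    whose difference is determined by their origins. *)
Lemma level_ex : exists lev : X -> int, forall x, lev (parent x) = lev x - 1.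
Proof.
have [c wc] := boundary_neq0.
pose o := c 0%N.
have mn x : {mn : nat * nat | iter mn.1 parent x = iter mn.2 parent o}.
  by apply: cid; have [m [n E]] := iter_parent_meet x o; exists (m, n).
exists (fun x => (sval (mn x)).1%:Z - (sval (mn x)).2%:Z) => x.
(* the ancestors of x and o meet in (m, n) and in (m'.+1, n') steps *)
case: (mn x) => -[m n] /= E; case: (mn (parent x)) => -[m' n'] /= E'.
suff : (m + n' = m'.+1 + n)%N by lia.
apply: (@iter_parent_inj x).
by rewrite addnC iterD E -iterD addnC iterD -E' -iterSr -iterD addnC.
Qed.

Lemma sectorP v y : sector w v y <-> exists n, iter n parent y = v.
Proof.
split=> [vy|[n <-] z [m _ <-]]; last first.
  by exists (m + n)%N => //; rewrite !rayE iterD.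
have [n _ yn] : range (ray w y) v by apply: vy; exists 0%N => //; rewrite rayE.
by exists n; rewrite -rayE.
Qed.

Section Level.
Variables (lev : X -> int) (levP : forall x, lev (parent x) = lev x - 1).

Lemma lev_iter n x : lev (iter n parent x) = lev x - n%:Z.
Proof. by elim: n => [|n IH] /=; rewrite ?levP ?IH; lia. Qed.

(** A walk changes the level by at most one per step, so no walk to the n-th
    ancestor is shorter than the ray segment. *)
Lemma dist_iter n x : dist x (iter n parent x) = n.
Proof.
rewrite /dist; case: ex_minnP => m /asboolP[p [xp px pm]] mP.
apply/eqP; rewrite eqn_leq mP /=; last first.
  apply/asboolP; exists (traject parent (parent x) n); split.
  - elim: n {mP px} x {xp} => [//|n IH] x /=; rewrite adj_parent /=; exact: IH.
  - by rewrite last_traject.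
  - by rewrite size_traject.
have : `|lev x - lev (last x p)| <= (size p)%:Z.
  elim: p x {px pm mP} xp => [|y p IH] x /=; first lia.
  rewrite adjP => /andP[xy /IH].
  by case/orP: xy => /eqP; [move=> -> | move=> <-]; rewrite levP; lia.
by rewrite px lev_iter pm; lia.
Qed.

Lemma meet_iter x y : exists m n,
  meet w x y = iter m parent x /\ meet w x y = iter n parent y.
Proof.
pose P z := range (ray w x) `&` range (ray w y) = range (ray w z).
have /(xgetPex x) : exists z, P z.
  have ex : exists m, `[< exists n, iter m parent x = iter n parent y >].
    by have [m [n E]] := iter_parent_meet x y; exists m; apply/asboolP; exists n.
  case: (ex_minnP ex) => m /asboolP[n E] mP.
  (* the first vertex of the ray of x that lies on the ray of y *)
  exists (iter m parent x); rewrite /P eqEsubset; split=> z.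
    move=> [[i _ <-] [j _ ]]; rewrite !rayE => ji.
    have mi : (m <= i)%N by apply: mP; apply/asboolP; exists j.
    by exists (i - m)%N => //; rewrite rayE -iterD subnK.
  move=> [i _ <-]; rewrite rayE; split.
    by exists (i + m)%N => //; rewrite rayE iterD.
  by exists (i + n)%N => //; rewrite rayE E iterD.
rewrite -/(meet w x y) => E.
have [[m _ mE] [n _ nE]] : (range (ray w x) `&` range (ray w y)) (meet w x y).
  by rewrite E; exists 0%N => //; rewrite rayE.
by exists m, n; rewrite -!rayE.
Qed.

Lemma dist_meet x y :
  (dist x (meet w x y))%:Z - (dist y (meet w x y))%:Z = lev x - lev y.
Proof.
have [m [n [mE nE]]] := meet_iter x y.
rewrite {1}mE nE !dist_iter.
by have := congr1 lev (etrans (esym mE) nE); rewrite !lev_iter; lia.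
Qed.

(** By dist_meet a horocycle is a level set of lev, which determines the
    horocyclic index up to the level of H. *)
Lemma hindex_lev H : is_horocycle w H ->
  exists k, forall x, hindex w H x = lev x - k.
Proof.
move=> [x0 HE]; exists (lev x0) => x.
have lev0 y : H y -> lev y = lev x0.
  by rewrite HE /= /same_horocycle => E; have := dist_meet x0 y; rewrite E; lia.
have Hx0 : H x0 by rewrite HE.
rewrite /hindex; case: xgetP => [k -> [y Hy]|].
  by have := dist_meet x y; rewrite (lev0 y Hy); lia.
move=> /(_ (lev x - lev x0)); case.
by exists x0 => //; have := dist_meet x x0; lia.
Qed.

End Level.

Lemma hindex_parent H : is_horocycle w H ->
  forall x, hindex w H (parent x) = hindex w H x - 1.
Proof.
have [lev levP] := level_ex => /(hindex_lev levP)[k hE] x.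
by rewrite !hE levP; lia.
Qed.

Definition children x : seq X :=
  [seq y <- fset_set [set y | adj x y] | parent y == x].

Lemma finite_adj x : finite_set [set y | adj x y].
Proof. by exists q.+1; exact: adj_degree. Qed.

Lemma mem_children x y : (y \in children x) = (parent y == x).
Proof.
rewrite mem_filter in_fset_set ?inE; last exact: finite_adj.
by rewrite andb_idr//= => /eqP yx; apply/mem_set => /=; rewrite adjP yx eqxx orbT.
Qed.

Lemma uniq_children x : uniq (children x).
Proof. exact/filter_uniq/fset_uniq. Qed.

Lemma perm_adj x :
  perm_eq (fset_set [set y | adj x y]) (parent x :: children x).
Proof.
apply: uniq_perm; first exact: fset_uniq.
  rewrite /= uniq_children andbT mem_children; exact/eqP/parent_parent.
move=> y; rewrite in_cons mem_children in_fset_set; last exact: finite_adj.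
by rewrite -adjP; apply/idP/idP => [/set_mem|/mem_set].
Qed.

Lemma size_children x : size (children x) = q.
Proof.
have := perm_size (perm_adj x).
by rewrite (card_fset_set (adj_degree x)) => -[].
Qed.

Lemma sum_adj (V : nmodType) (f : X -> V) x :
  \sum_(y \in [set y | adj x y]) f y = f (parent x) + \sum_(y <- children x) f y.
Proof.
rewrite fsbig_finite; last exact: finite_adj.
by rewrite (perm_big _ (perm_adj x)) big_cons.
Qed.

End Rays.

(** * Unconditional sums *)

Section FiniteSums.
Variables (R : realType) (T : choiceType).
Implicit Types (D : set T) (f g : T -> R) (s : seq T).

Lemma ler_sum_uniq f s s' : (forall x, 0 <= f x) -> uniq s -> uniq s' ->
  (forall x, x \in s -> f x != 0 -> x \in s') ->
  \sum_(x <- s) f x <= \sum_(x <- s') f x.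
Proof.
move=> f0 us us' ss'.
rewrite (bigID (fun x => f x == 0)) /= big1 ?add0r; last by move=> x /eqP.
rewrite -big_filter.
have sE : perm_eq [seq x <- s | f x != 0] [seq x <- s' | (x \in s) && (f x != 0)].
  apply: uniq_perm; rewrite ?filter_uniq// => x; rewrite !mem_filter.
  by case: (boolP (x \in s)) => xs; case: eqVneq => //= /(ss' _ xs) ->.
rewrite (perm_big _ sE) big_filter [leRHS](bigID (fun x => (x \in s) && (f x != 0))) /=.
by rewrite lerDl sumr_ge0.
Qed.

Lemma esum_le D f (b : R) :
  (forall s, uniq s -> (forall x, x \in s -> D x) -> \sum_(x <- s) f x <= b) ->
  (\esum_(x in D) (f x)%:E <= b%:E)%E.
Proof.
move=> fb; apply: ub_ereal_sup => _ [A [fA AD] <-].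
rewrite fsbig_finite// sumEFin lee_fin; apply: fb; first exact: fset_uniq.
by move=> x; rewrite in_fset_set// => /set_mem /AD.
Qed.

Lemma esum_ge_seq D f s : uniq s -> (forall x, x \in s -> D x) ->
  ((\sum_(x <- s) f x)%:E <= \esum_(x in D) (f x)%:E)%E.
Proof.
move=> us sD; apply: ereal_sup_ubound; exists [set` s].
  by split; [exact: finite_seq|exact: sD].
by rewrite -fsbig_seq// sumEFin.
Qed.

Lemma esum_fin_num D f : (forall x, 0 <= f x) ->
  (\esum_(x in D) (f x)%:E < +oo)%E -> \esum_(x in D) (f x)%:E \is a fin_num.
Proof. by move=> f0 foo; rewrite ge0_fin_numE// esum_ge0// => x _; rewrite lee_fin. Qed.

(** A finite set that nearly attains the supremum is, up to zeros of g, contained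
    in F n for large n. *)
Lemma esum_cvg g (F : nat -> seq T) : (forall x, 0 <= g x) ->
  (\esum_(x in [set: T]) (g x)%:E < +oo)%E -> (forall n, uniq (F n)) ->
  (forall x, g x != 0 -> exists N, forall n, (N <= n)%N -> x \in F n) ->
  (fun n => \sum_(x <- F n) g x) @ \oo -->
    fine (\esum_(x in [set: T]) (g x)%:E).
Proof.
move=> g0 goo uF gF; have gfin := esum_fin_num g0 goo.
have sF (s : seq T) : exists N, forall n, (N <= n)%N ->
    forall x, x \in s -> g x != 0 -> x \in F n.
  elim: s => [|y s [N NE]]; first by exists 0%N.
  have [gy|/gF[M ME]] := eqVneq (g y) 0.
    exists N => n Nn x; rewrite in_cons => /orP[/eqP->|]; last exact: NE.
    by rewrite gy eqxx.
  exists (maxn N M) => n; rewrite geq_max => /andP[Nn Mn] x.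
  by rewrite in_cons => /orP[/eqP-> _|]; [exact: ME|exact: NE].
apply/cvgrPdist_le => e e0.
have [A fA Ae] : exists2 A, finite_set A &
    (\esum_(x in [set: T]) (g x)%:E - e%:E < \sum_(x \in A) (g x)%:E)%E.
  by have [_ [A [fA _] <-]] := ub_ereal_sup_adherent e0 gfin; exists A.
have [N NE] := sF (fset_set A); exists N => //= n Nn.
have le1 : \sum_(x <- F n) g x <= fine (\esum_(x in [set: T]) (g x)%:E).
  by rewrite -lee_fin fineK// esum_ge_seq.
rewrite ger0_norm ?subr_ge0// lerBlDl -lerBlDr.
have le2 : \sum_(x <- fset_set A) g x <= \sum_(x <- F n) g x.
  by apply: ler_sum_uniq; [|exact: fset_uniq| |exact: NE].
apply: le_trans le2; apply: ltW.
by rewrite -lte_fin EFinB fineK// -sumEFin -fsbig_finite.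
Qed.

(** It gives access to bergman_inner, which is defined by suprema of positive
    and negative parts, through finite sums over generations, to which
    harmonicity applies. *)
Lemma rsum_cvg g (F : nat -> seq T) :
  (\esum_(x in [set: T]) `|g x|%:E < +oo)%E -> (forall n, uniq (F n)) ->
  (forall x, g x != 0 -> exists N, forall n, (N <= n)%N -> x \in F n) ->
  (fun n => \sum_(x <- F n) g x) @ \oo --> rsum g.
Proof.
move=> goo uF gF; rewrite /rsum.
have -> : (fun n => \sum_(x <- F n) g x) =
  (fun n => \sum_(x <- F n) Num.max (g x) 0 - \sum_(x <- F n) Num.max (- g x) 0).
  apply/funext => n; rewrite -sumrB; apply: eq_bigr => x _.
  by rewrite /Num.max; case: ltP => ?; case: ltP => ?; lra.
have pos (k : T -> R) : (forall x, `|k x| = `|g x|) ->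
    (fun n => \sum_(x <- F n) Num.max (k x) 0) @ \oo -->
      fine (\esum_(x in [set: T]) (Num.max (k x) 0)%:E).
  move=> kg; apply: esum_cvg => [x|||x kx].
  - by rewrite le_max lexx orbT.
  - apply: le_lt_trans goo; apply: le_esum => x _.
    by rewrite lee_fin -kg ge_max normr_ge0 ler_norm.
  - exact: uF.
  - apply: gF; apply: contra_neq kx => gx.
    by have /eqP := kg x; rewrite gx normr0 normr_eq0 => /eqP ->; rewrite maxxx.
by apply: cvgB; apply: pos => x; rewrite ?normrN.
Qed.

Lemma rsum_le_norm g (F : nat -> seq T) (b : R) :
  (\esum_(x in [set: T]) `|g x|%:E < +oo)%E -> (forall n, uniq (F n)) ->
  (forall x, g x != 0 -> exists N, forall n, (N <= n)%N -> x \in F n) ->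
  (forall n, (0 < n)%N -> b <= `|\sum_(x <- F n) g x|) -> b <= `|rsum g|.
Proof.
move=> goo uF gF bF; have /cvg_norm gc := rsum_cvg goo uF gF.
rewrite -(cvg_lim _ gc)//; apply: limr_ge; first by apply: cvgP gc.
by exists 1%N => // n /= n0; exact: bF.
Qed.

End FiniteSums.

(** * Generations below a vertex *)

Section Descendants.
Variables (q : nat) (X : homogeneous_tree q).
Variables (w : set (nat -> X)) (hw : is_boundary_point w).
Implicit Types (x y z u c : X).

Fixpoint descendants n u : seq X :=
  if n is m.+1 then [seq y | x <- descendants m u, y <- children w x] else [:: u].

Lemma mem_descendants n u z : (z \in descendants n u) = (iter n (parent w) z == u).
Proof.
elim: n z => [|n IH] z; first by rewrite /= inE.
rewrite iterSr -IH /=; apply/allpairsPdep/idP => [[x [y [xu yx ->]]]|zu].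
  by move: yx; rewrite mem_children// => /eqP->.
by exists (parent w z), z; rewrite mem_children// eqxx.
Qed.

Lemma uniq_descendants n u : uniq (descendants n u).
Proof.
elim: n => [//|n IH]; apply: allpairs_uniq_dep => //.
  by move=> x _; exact: uniq_children.
move=> /= [x y] [x' y'] /allpairsPdep[x1 [y1 [_ h1 [-> ->]]]].
move=> /allpairsPdep[x2 [y2 [_ h2 [-> ->]]]] /= y12.
move: h1 h2; rewrite !mem_children// => /eqP<- /eqP<-.
by rewrite y12.
Qed.

Lemma big_descendantsS (V : nmodType) (f : X -> V) n u :
  \sum_(z <- descendants n.+1 u) f z =
  \sum_(z <- descendants n u) \sum_(y <- children w z) f y.
Proof. by rewrite /= big_allpairs_dep. Qed.

Definition sector_ball N u := [seq z | n <- iota 0 N, z <- descendants n u].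

Lemma mem_sector_ball N u z :
  reflect (exists2 n, (n < N)%N & iter n (parent w) z = u) (z \in sector_ball N u).
Proof.
apply: (iffP allpairsPdep) => [[n [y [nN yu ->]]]|[n nN zu]].
  by exists n; [move: nN; rewrite mem_iota|apply/eqP; rewrite -mem_descendants].
by exists n, z; rewrite mem_iota mem_descendants zu eqxx.
Qed.

Lemma uniq_sector_ball N u : uniq (sector_ball N u).
Proof.
apply: allpairs_uniq_dep; first exact: iota_uniq.
  by move=> n _; exact: uniq_descendants.
move=> /= [n y] [n' y'] /allpairsPdep[m [z [_ + [-> ->]]]].
rewrite mem_descendants => /eqP mz.
move=> /allpairsPdep[m' [z' [_ + [-> ->]]]] /=.
rewrite mem_descendants => /eqP mz' zz'; move: mz'; rewrite -zz' -mz.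
by move=> /(iter_parent_inj hw) ->.
Qed.

Lemma big_sector_ball (V : nmodType) (f : X -> V) N u :
  \sum_(z <- sector_ball N u) f z =
  \sum_(n <- iota 0 N) \sum_(z <- descendants n u) f z.
Proof. by rewrite big_allpairs_dep. Qed.

End Descendants.

(** * Weights with a constant ratio between generations *)

Section Weight.
Variables (R : realType) (q : nat) (X : homogeneous_tree q).
Variables (w : set (nat -> X)) (hw : is_boundary_point w).
Variables (rho : R) (rho_gt0 : 0 < rho) (q_rho_lt1 : q%:R * rho < 1).
Variables (sg : X -> R) (sg_gt0 : forall x, 0 < sg x).
Hypothesis sg_parent : forall x, sg x = rho * sg (parent w x).
Implicit Types (x y z u v c : X).
Local Notation parent := (parent w).

Lemma weight_iter n x : sg x = rho ^+ n * sg (iter n parent x).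
Proof.
elim: n => [|n IH]; first by rewrite mul1r.
by rewrite IH iterS sg_parent exprSr mulrA.
Qed.

Lemma sum_weight_descendants n u :
  \sum_(z <- descendants w n u) sg z = (q%:R * rho) ^+ n * sg u.
Proof.
elim: n => [|n IH]; first by rewrite big_seq1 mul1r.
rewrite big_descendantsS exprS -mulrA -IH mulr_sumr; apply: eq_bigr => x _.
rewrite (eq_big_seq (fun=> rho * sg x)) => [|y]; last first.
  by rewrite mem_children// sg_parent => /eqP ->.
rewrite big_const_seq count_predT size_children// iter_addr addr0.
by rewrite -mulrA mulr_natl.
Qed.

Lemma sum_weight_sector_all s u : uniq s -> (forall z, z \in s -> sector w u z) ->
  \sum_(z <- s) sg z <= sg u / (1 - q%:R * rho).
Proof.
move=> us su.
have qr0 : 0 <= q%:R * rho by rewrite mulr_ge0// ltW ?rho_gt0.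
have [N sN] : exists N, {subset s <= sector_ball w N u}.
  elim: s {us} su => [|y s IH] su; first by exists 0%N.
  have [n nE] : exists n, iter n parent y = u.
    by apply/(sectorP hw)/su; rewrite mem_head.
  have [N sN] : exists N, {subset s <= sector_ball w N u}.
    by apply: IH => z zs; apply: su; rewrite in_cons zs orbT.
  exists (maxn n.+1 N) => z; rewrite in_cons => /orP[/eqP->|/sN].
    by apply/mem_sector_ball => //; exists n; rewrite // leq_max leqnn.
  move=> /(mem_sector_ball hw)[m mN mE].
  by apply/mem_sector_ball => //; exists m; rewrite // leq_max mN orbT.
apply: (@le_trans _ _ (\sum_(z <- sector_ball w N u) sg z)).
  apply: ler_sum_uniq => //; first by move=> z; exact/ltW/sg_gt0.
    exact: uniq_sector_ball.
  by move=> x xs _; exact: sN.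
rewrite big_sector_ball (eq_bigr _ (fun n _ => sum_weight_descendants n u)).
rewrite -mulr_suml mulrC ler_pM2l ?sg_gt0//.
rewrite -[leRHS]mul1r ler_pdivlMr ?subr_gt0// mulrC.
have -> : \sum_(n <- iota 0 N) (q%:R * rho) ^+ n =
          \sum_(n < N) (q%:R * rho) ^+ n.
  by rewrite -(big_mkord xpredT (fun n => (q%:R * rho) ^+ n)) /index_iota subn0.
by rewrite -opprB mulNr -subrX1 opprB gerBl exprn_ge0.
Qed.

(** A sector carries q ^ n vertices at depth n, of weight rho ^ n relative to
    its root; the bound is the sum of the geometric series of ratio q * rho. *)
Lemma sum_weight_sector s u : uniq s ->
  \sum_(z <- s | `[< sector w u z >]) sg z <= sg u / (1 - q%:R * rho).
Proof.
move=> us; rewrite -big_filter; apply: sum_weight_sector_all.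
  exact: filter_uniq.
by move=> z; rewrite mem_filter => /andP[/asboolP].
Qed.

End Weight.

(** * Harmonic functions that separate two siblings *)

Section TestFunctions.
Variables (R : realType) (q : nat) (hq : (2 <= q)%N) (X : homogeneous_tree q).
Variables (w : set (nat -> X)) (hw : is_boundary_point w).
Variables (lev : X -> int) (levP : forall x, lev (parent w x) = lev x - 1).
Implicit Types (x y z u v c : X) (a : X -> R).
Local Notation parent := (parent w).

Lemma q_gt0 : 0 < q%:R :> R.
Proof. by rewrite ltr0n; lia. Qed.

Definition real_harmonic a := forall x,
  q.+1%:R * a x = a (parent x) + \sum_(y <- children w x) a y.

Definition increment a x := a x - a (parent x).

(** The number of steps from z up to c is the difference of their levels, which
    gives a closed form for a function of the depth below c. *)
Definition sector_potential c z : R :=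
  if `[< sector w c z >]
  then 1 - q%:R^-1 ^+ (`|lev z - lev c|%N).+1 else 0.

Lemma sector_potential_iter n c z : iter n parent z = c ->
  sector_potential c z = 1 - q%:R^-1 ^+ n.+1.
Proof.
move=> nE; rewrite /sector_potential ifT; last first.
  by apply/asboolP/(sectorP hw); exists n.
congr (_ - _ ^+ _.+1); rewrite -nE (lev_iter levP).
by clear; lia.
Qed.

Lemma sector_potential_out c z : ~ sector w c z -> sector_potential c z = 0.
Proof. by move=> cz; rewrite /sector_potential ifF//; apply/asboolP. Qed.

Lemma sector_parent c z : sector w c (parent z) -> sector w c z.
Proof.
by move=> /(sectorP hw)[n nE]; apply/(sectorP hw); exists n.+1; rewrite iterSr.
Qed.

Lemma sector_child c z : sector w c z -> z = c \/ sector w c (parent z).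
Proof.
move=> /(sectorP hw)[[|n] nE]; [by left|right].
by apply/(sectorP hw); exists n; rewrite -iterSr.
Qed.

Lemma qV_gt0 : 0 < q%:R^-1 :> R.
Proof. by rewrite invr_gt0 q_gt0. Qed.

Lemma qV_le : q%:R^-1 <= 2^-1 :> R.
Proof. by rewrite lef_pV2 ?posrE ?q_gt0// ler_nat. Qed.

Lemma qVX_le n : 0 <= 1 - (q%:R^-1 : R) ^+ n <= 1.
Proof.
have r0 := ltW qV_gt0; have r1 : (q%:R^-1 : R) <= 1 by have := qV_le; lra.
by rewrite subr_ge0 exprn_ile1//= gerBl exprn_ge0.
Qed.

Lemma sector_potential_bound c z : 0 <= sector_potential c z <= 1.
Proof.
by rewrite /sector_potential; case: ifP => _; rewrite ?qVX_le// lexx ler01.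
Qed.

Lemma sum_const_children (b : R) x : \sum_(y <- children w x) b = q%:R * b.
Proof.
by rewrite big_const_seq count_predT size_children// iter_addr addr0 mulr_natl.
Qed.

(** 1 - q ^ (- n) is the solution, vanishing at n = 0, of the recursion that
    radial harmonic functions satisfy. Starting it at the parent of c
    makes the only defect of harmonicity a constant at that vertex, the same for
    all siblings. *)
Lemma sector_potential_laplacian c x :
  sector_potential c (parent x) + \sum_(y <- children w x) sector_potential c y
  - q.+1%:R * sector_potential c x = if x == parent c then 1 - q%:R^-1 else 0.
Proof.
have [cx|cx] := pselect (sector w c x).
  have /(sectorP hw)[n nE] := cx.
  rewrite ifF; last first.
    apply/eqP => xE.
    have : iter n.+1 parent x = iter 0 parent x by rewrite /= nE -xE.
    by move=> /(iter_parent_inj hw).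
  rewrite (sector_potential_iter nE).
  rewrite (eq_big_seq (fun=> 1 - q%:R^-1 ^+ n.+2)) => [|y]; last first.
    rewrite mem_children// => /eqP yx.
    by apply: sector_potential_iter; rewrite iterSr yx.
  have -> : sector_potential c (parent x) = 1 - q%:R^-1 ^+ n.
    case: n nE => [xc|n nE]; last by apply: sector_potential_iter; rewrite -iterSr.
    rewrite expr0 subrr; apply: sector_potential_out => /(sectorP hw)[m mE].
    have : iter m.+1 parent x = iter 0 parent x by rewrite iterSr mE -xc.
    by move=> /(iter_parent_inj hw).
  rewrite sum_const_children -natr1 !exprS.
  by field; exact: lt0r_neq0 q_gt0.
have cpx : ~ sector w c (parent x) by move=> /sector_parent.
rewrite !(sector_potential_out cx) (sector_potential_out cpx) mulr0 subr0 add0r.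
have [->|xc] := eqVneq x (parent c).
  rewrite (bigD1_seq c) ?mem_children//= ?uniq_children//.
  rewrite (@sector_potential_iter 0)// expr1 big_seq_cond big1 ?addr0// => y.
  rewrite mem_children// => /andP[/eqP yc yNc]; apply: sector_potential_out.
  move=> /sector_child[yc'|]; first by rewrite yc' eqxx in yNc.
  rewrite yc => /(sectorP hw)[m mE].
  have : iter m.+1 parent c = iter 0 parent c by rewrite iterSr mE.
  by move=> /(iter_parent_inj hw).
rewrite big_seq big1// => y; rewrite mem_children// => /eqP yx.
apply: sector_potential_out => /sector_child[yc|]; last by rewrite yx.
by move: xc; rewrite -yx yc eqxx.
Qed.

Definition sibling_potential c c' z :=
  sector_potential c z - sector_potential c' z.

Lemma sibling_potential_harmonic c c' : parent c = parent c' ->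
  real_harmonic (sibling_potential c c').
Proof.
move=> cc' x; rewrite /sibling_potential sumrB.
have := sector_potential_laplacian c x; have := sector_potential_laplacian c' x.
by rewrite cc' => E E'; move: E'; rewrite -E; lra.
Qed.

Lemma sibling_potential_bound c c' z : `|sibling_potential c c' z| <= 1.
Proof.
have /andP[a0 a1] := sector_potential_bound c z.
have /andP[b0 b1] := sector_potential_bound c' z.
by rewrite /sibling_potential ler_norml; lra.
Qed.

Lemma sibling_potential_out c c' z : parent c = parent c' ->
  ~ sector w (parent c) z -> sibling_potential c c' z = 0.
Proof.
move=> cc' uz; rewrite /sibling_potential !sector_potential_out ?subrr//.
- move=> /(sectorP hw)[n nE]; apply: uz; apply/(sectorP hw).
  by exists n.+1; rewrite /= nE cc'.
- move=> /(sectorP hw)[n nE]; apply: uz; apply/(sectorP hw).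
  by exists n.+1; rewrite /= nE.
Qed.

(** Summing the harmonicity equation over generation n gives a second-order
    recursion in n, with characteristic roots 1 and q; its solutions also
    satisfy a first-order recursion with a constant term, read off at n = 0. *)
Lemma sum_descendants_harmonic a n u : real_harmonic a ->
  \sum_(z <- descendants w n.+1 u) a z =
  q%:R * (\sum_(z <- descendants w n u) a z) + increment a u.
Proof.
move=> ha.
have hs k : \sum_(z <- descendants w k.+1 u) a z =
    q.+1%:R * (\sum_(z <- descendants w k u) a z) -
    \sum_(z <- descendants w k u) a (parent z).
  rewrite big_descendantsS mulr_sumr -sumrB; apply: eq_bigr => z _.
  by rewrite ha; lra.
elim: n => [|n IH]; first by rewrite hs !big_seq1 /increment -natr1; lra.
rewrite hs.
have -> : \sum_(z <- descendants w n.+1 u) a (parent z) =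
          q%:R * \sum_(z <- descendants w n u) a z.
  rewrite big_descendantsS mulr_sumr; apply: eq_bigr => z _.
  rewrite (eq_big_seq (fun=> a z)) ?sum_const_children// => y.
  by rewrite mem_children// => /eqP ->.
by rewrite -natr1; move: IH; lra.
Qed.

(** The constant terms of sum_descendants_harmonic at two siblings differ by
    a c - a c', since the parent is common; hence a c - a c' factors out. *)
Lemma sum_descendants_sibling a c c' n :
    real_harmonic a -> parent c = parent c' ->
  \sum_(z <- descendants w n c) a z - \sum_(z <- descendants w n c') a z =
  (\sum_(i < n.+1) q%:R ^+ i) * (a c - a c').
Proof.
move=> ha cc'; elim: n => [|n IH]; first by rewrite !big_seq1 big_ord1 mul1r.
rewrite !sum_descendants_harmonic// big_ord_recl expr0.
rewrite (eq_bigr (fun i : 'I_n.+1 => q%:R * q%:R ^+ i)) => [|i _]; last first.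
  by rewrite -exprS.
by rewrite -mulr_sumr mulrDl -mulrA -IH /increment cc' mul1r; ring.
Qed.

End TestFunctions.

(** * Estimates for real harmonic functions *)

Section Estimates.
Variables (R : realType) (q : nat) (hq : (2 <= q)%N) (X : homogeneous_tree q).
Variables (w : set (nat -> X)) (hw : is_boundary_point w).
Variables (lev : X -> int) (levP : forall x, lev (parent w x) = lev x - 1).
Variables (rho : R) (rho_gt0 : 0 < rho) (q_rho_lt1 : q%:R * rho < 1).
Variables (sg : X -> R) (sg_gt0 : forall x, 0 < sg x).
Hypothesis sg_parent : forall x, sg x = rho * sg (parent w x).
Implicit Types (x y z u v c : X) (a : X -> R).
Local Notation parent := (parent w).
Local Notation r := (q%:R^-1 : R).

Lemma sibling_depth c c' z m n : parent c = parent c' ->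
  iter m parent z = c -> iter n parent z = c' -> m = n.
Proof.
move=> cc' mE nE; suff : m.+1 = n.+1 by case.
by apply: (@iter_parent_inj _ _ _ hw z); rewrite /= mE nE.
Qed.

Lemma descendants_pairing a c c' n : parent c = parent c' -> c != c' ->
  \sum_(z <- descendants w n c) sibling_potential R w lev c c' z * a z * sg z =
  (1 - r ^+ n.+1) * rho ^+ n * sg c * \sum_(z <- descendants w n c) a z.
Proof.
move=> cc' cNc'; rewrite mulr_sumr; apply: eq_big_seq => z.
rewrite mem_descendants// => /eqP zc.
rewrite /sibling_potential (sector_potential_iter _ hw levP zc).
rewrite sector_potential_out ?subr0.
  by rewrite (weight_iter sg_parent n z) zc; ring.
move=> /(sectorP hw)[m mE].
by move: cNc'; rewrite -zc -mE (sibling_depth cc' zc mE) eqxx.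
Qed.

Definition pairing_factor n : R :=
  (1 - r ^+ n.+1) * rho ^+ n * \sum_(i < n.+1) q%:R ^+ i.

Lemma pairing_factor_ge0 n : 0 <= pairing_factor n.
Proof.
have /andP[r0 _] := qVX_le R hq n.+1.
rewrite !mulr_ge0 ?exprn_ge0 ?(ltW rho_gt0)//.
by apply: sumr_ge0 => i _; rewrite exprn_ge0.
Qed.

Lemma sector_ball_pairing a c c' N : real_harmonic w a ->
    parent c = parent c' -> c != c' ->
  \sum_(z <- sector_ball w N c ++ sector_ball w N c')
    sibling_potential R w lev c c' z * a z * sg z =
  (\sum_(n <- iota 0 N) pairing_factor n) * sg c * (a c - a c').
Proof.
move=> ha cc' cNc'; rewrite big_cat /= !big_sector_ball !mulr_suml -big_split /=.
apply: eq_bigr => n _; rewrite descendants_pairing//.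
have sgc : sg c' = sg c by rewrite !(sg_parent c) sg_parent cc'.
have -> : \sum_(z <- descendants w n c')
      sibling_potential R w lev c c' z * a z * sg z =
    - \sum_(z <- descendants w n c')
      sibling_potential R w lev c' c z * a z * sg z.
  by rewrite -sumrN; apply: eq_bigr => z _; rewrite -!mulNr /sibling_potential opprB.
rewrite descendants_pairing 1?eq_sym// sgc -mulrBr sum_descendants_sibling//.
by rewrite /pairing_factor; ring.
Qed.

(** |f a| <= 1 + a ^ 2 on the sector of the parent, which has finite weight. *)
Lemma sibling_pairing_summable a c c' :
  (\esum_(z in [set: X]) (a z ^+ 2 * sg z)%:E < +oo)%E -> parent c = parent c' ->
  (\esum_(z in [set: X])
    `|sibling_potential R w lev c c' z * a z * sg z|%:E < +oo)%E.
Proof.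
move=> aoo cc'; set E := \esum_(z in _) _ in aoo.
have Efin : E \is a fin_num.
  by apply: esum_fin_num => // x; rewrite mulr_ge0 ?sqr_ge0// ltW.
apply: (@le_lt_trans _ _ (sg (parent c) / (1 - q%:R * rho) + fine E)%:E).
  2: exact: ltry.
apply: esum_le => s us _.
apply: (@le_trans _ _ (\sum_(z <- s | `[< sector w (parent c) z >]) sg z +
                       \sum_(z <- s) a z ^+ 2 * sg z)).
  rewrite [X in _ <= X + _]big_mkcond -big_split /=; apply: ler_sum => z _.
  have sz := sg_gt0 z.
  rewrite !normrM (gtr0_norm sz); case: asboolP => uz; last first.
    rewrite sibling_potential_out//.
    by rewrite normr0 !mul0r add0r mulr_ge0 ?sqr_ge0// (ltW sz).
  rewrite -[X in X + _]mul1r -mulrDl ler_pM2r//.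
  apply: (@le_trans _ _ `|a z|).
    by rewrite ler_piMl// (sibling_potential_bound R hq w lev c c' z).
  rewrite -real_normK ?num_real//; have := sqr_ge0 (`|a z| - 1); nra.
rewrite lerD//.
  exact: (sum_weight_sector hw rho_gt0 q_rho_lt1 sg_gt0 sg_parent).
by rewrite -lee_fin fineK//; apply: esum_ge_seq.
Qed.

(** By sector_ball_pairing the partial sums over the first generations are
    sg c * (a c - a c') times a sum of nonnegative factors, the first of which
    already is 1 - r; the lower bound passes to the limit. *)
Lemma sibling_estimate a c c' : real_harmonic w a ->
    (\esum_(z in [set: X]) (a z ^+ 2 * sg z)%:E < +oo)%E ->
    parent c = parent c' -> c != c' ->
  (1 - r) * sg c * `|a c - a c'| <=
  `|rsum (fun z => sibling_potential R w lev c c' z * a z * sg z)|.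
Proof.
move=> ha aoo cc' cNc'.
pose F N := sector_ball w N c ++ sector_ball w N c'.
apply: (@rsum_le_norm _ _ _ F).
- exact: sibling_pairing_summable.
- move=> N; rewrite /F cat_uniq !uniq_sector_ball//= andbT.
  apply/hasPn => z /(mem_sector_ball hw)[m _ mE].
  apply/negP => /(mem_sector_ball hw)[n _ nE].
  by move: cNc'; rewrite -mE -nE (sibling_depth cc' nE mE) eqxx.
- move=> z.
  have inb d : sector w d z ->
      exists N, forall n, (N <= n)%N -> z \in sector_ball w n d.
    move=> /(sectorP hw)[m mE]; exists m.+1 => n mn.
    by apply/mem_sector_ball => //; exists m.
  have [/inb[N NE]|cz] := pselect (sector w c z).
    by exists N => n Nn; rewrite /F mem_cat NE.
  have [/inb[N NE]|cz'] := pselect (sector w c' z).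
    by exists N => n Nn; rewrite /F mem_cat NE// orbT.
  by rewrite /sibling_potential !sector_potential_out// subrr !mul0r eqxx.
- move=> N N0; rewrite /F sector_ball_pairing// normrM ler_wpM2r//.
  have s0 : 0 <= \sum_(n <- iota 0 N) pairing_factor n.
    by apply: sumr_ge0 => n _; exact: pairing_factor_ge0.
  rewrite ger0_norm ?mulr_ge0// ?(ltW (sg_gt0 _))// ler_pM2r//.
  case: N N0 {s0} => // N _; rewrite /= big_cons.
  rewrite {1}/pairing_factor big_ord1 !expr0 expr1 !mulr1 lerDl.
  by apply: sumr_ge0 => n _; exact: pairing_factor_ge0.
Qed.

(** Harmonicity at the parent u of c expresses q times the increment at c as
    the increment at u plus the differences of c with its siblings. *)
Lemma increment_step a c (b : R) : real_harmonic w a ->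
    (forall c', parent c' = parent c -> `|a c - a c'| <= b) ->
  `|increment w a c| <= r * `|increment w a (parent c)| + b.
Proof.
move=> ha ab; have q0 := q_gt0 R hq.
have E : q%:R * increment w a c =
    \sum_(y <- children w (parent c)) (a c - a y) + increment w a (parent c).
  rewrite sumrB sum_const_children//; have := ha (parent c).
  by rewrite -natr1 /increment; lra.
have : `|q%:R * increment w a c| <= q%:R * b + `|increment w a (parent c)|.
  rewrite E; apply: le_trans (ler_normD _ _) _; rewrite lerD2r.
  apply: le_trans (ler_norm_sum _ _ _) _.
  rewrite -(sum_const_children hw b (parent c)) big_seq [leRHS]big_seq.
  by apply: ler_sum => y; rewrite mem_children// => /eqP /ab.
rewrite normrM gtr0_norm// => le1.
by rewrite -(ler_pM2l q0) mulrDr mulrA mulfV ?mul1r 1?addrC ?gt_eqF.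
Qed.

Section Oscillation.
Variables (a : X -> R) (b : X -> R).
Hypothesis ha : real_harmonic w a.
Hypothesis ab : forall c c', parent c' = parent c ->
  `|a c - a c'| <= b (parent c).

(** increment_step, iterated along the ray of v. *)
Lemma increment_bound N v : `|increment w a v| <=
  \sum_(j < N) r ^+ j * b (iter j.+1 parent v) +
  r ^+ N * `|increment w a (iter N parent v)|.
Proof.
elim: N => [|N IH]; first by rewrite big_ord0 add0r mul1r.
apply: le_trans IH _; rewrite big_ord_recr /= -addrA lerD2l.
rewrite exprSr -mulrA -mulrDr ler_wpM2l ?exprn_ge0 ?(ltW (qV_gt0 R hq))// addrC.
by apply: increment_step => // c' /ab.
Qed.

(** Where the bound b vanishes, harmonicity forces the increments to decay by
    the factor 1 / q at each generation; since q >= 2, their sum along any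
    descending path is at most the initial one. *)
Lemma oscillation_sector v x : (forall u, sector w v u -> b u = 0) ->
  sector w v x -> `|a x - a v| <= `|increment w a v|.
Proof.
move=> bv /(sectorP hw)[n nE].
have r0 := qV_gt0 R hq; have r2 := qV_le R hq.
suff [_ le1] : `|increment w a x| <= r ^+ n * `|increment w a v| /\
    `|a x - a v| <= (1 - r ^+ n) * `|increment w a v|.
  by apply: le_trans le1 _; rewrite ler_piMl.
elim: n x nE => [|n IH] x nE.
  by rewrite -nE /= subrr normr0 !expr0 !(mul1r, subrr, mul0r).
rewrite iterSr in nE; have [le1 le2] := IH _ nE.
have le3 : `|increment w a x| <= r ^+ n.+1 * `|increment w a v|.
  have le4 : `|increment w a x| <= r * `|increment w a (parent x)| + 0.
    apply: increment_step => // c' /ab; rewrite bv//.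
    by apply/(sectorP hw); exists n.
  rewrite addr0 in le4; apply: le_trans le4 _.
  by rewrite exprS -mulrA ler_wpM2l// (ltW r0).
split=> //.
have -> : a x - a v = increment w a x + (a (parent x) - a v).
  by rewrite /increment; ring.
apply: le_trans (ler_normD _ _) _; apply: le_trans (lerD le3 le2) _.
rewrite -mulrDl ler_wpM2r//.
have := exprn_ge0 n (ltW r0); rewrite exprS; nra.
Qed.

End Oscillation.

Lemma sum_qVX_le2 N : \sum_(j < N) r ^+ j <= 2.
Proof.
have r0 := qV_gt0 R hq; have r2 := qV_le R hq.
(* the subtracted term makes the induction go through, as r <= 1 / 2 *)
suff : \sum_(j < N) r ^+ j <= 2 - 2 * r ^+ N.
  by have := exprn_ge0 N (ltW r0); lra.
elim: N => [|N IH]; first by rewrite big_ord0 expr0; lra.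
rewrite big_ord_recr /= exprS; have := exprn_ge0 N (ltW r0); nra.
Qed.

Lemma le_geometric_limit (s b e : R) : (forall N, s <= b + r ^+ N * e) -> s <= b.
Proof.
have r0 := qV_gt0 R hq; have r2 := qV_le R hq.
move=> sb.
have cv : (fun N => b + r ^+ N * e) @ \oo --> b + 0 * e.
  apply: cvgD; first exact: cvg_cst.
  by apply: cvgMl; apply: cvg_expr; rewrite ger0_norm ?(ltW r0)//; lra.
rewrite -[leRHS]addr0 -(mul0r e) -(cvg_lim _ cv)//.
by apply: limr_ge; [exact: cvgP cv|near=> N; exact: sb].
Unshelve. all: by end_near. Qed.

(** Each a z is meant to be a part of the kernel at z. After summation over z,
    the bound k / sg u on the sector of an ancestor u of v contributes a bounded
    amount, because the weight of that sector is a multiple of sg u; the factors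
    r ^ j of increment_bound make the sum over the ancestors converge. The
    remainder in increment_bound tends to 0 since s is finite and the increments
    of each a z are bounded along the ray of v. *)
Lemma sum_oscillation_le (k : R) (a : X -> X -> R) v x y (s : seq X) :
  0 <= k ->
  (forall z, real_harmonic w (a z)) ->
  (forall z c c', parent c' = parent c ->
    `|a z c - a z c'| <=
    if `[< sector w (parent c) z >] then k / sg (parent c) else 0) ->
  (forall z, exists C, forall N, `|increment w (a z) (iter N parent v)| <= C) ->
  sector w v x -> sector w v y ->
  uniq s -> (forall z, z \in s -> ~ sector w v z) ->
  \sum_(z <- s) `|a z x - a z y| * sg z <= 4 * k / (1 - q%:R * rho).
Proof.
move=> k0 ha ab /choice[C CE] vx vy us sv.
have qr : 0 < 1 - q%:R * rho by rewrite subr_gt0.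
pose b z u : R := if `[< sector w u z >] then k / sg u else 0.
apply: (@le_geometric_limit _ _ (2 * \sum_(z <- s) C z * sg z)) => N.
apply: (@le_trans _ _ (2 * \sum_(z <- s) `|increment w (a z) v| * sg z)).
  rewrite mulr_sumr big_seq [leRHS]big_seq; apply: ler_sum => z zs.
  rewrite mulrA ler_pM2r//.
  have bv u : sector w v u -> b z u = 0.
    move=> vu; rewrite /b ifF//; apply/asboolP => uz; apply: (sv z zs).
    by move=> t /vu /uz.
  have := @oscillation_sector _ (b z) (ha z) (ab z) v x bv vx.
  have := @oscillation_sector _ (b z) (ha z) (ab z) v y bv vy.
  have -> : a z x - a z y = (a z x - a z v) - (a z y - a z v) by ring.
  by move=> l1 l2; apply: le_trans (ler_normB _ _) _; lra.
have bsum u : \sum_(z <- s) b z u * sg z <= k / (1 - q%:R * rho).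
  apply: (@le_trans _ _ (k / sg u * \sum_(z <- s | `[< sector w u z >]) sg z)).
    rewrite mulr_sumr [leRHS]big_mkcond /=; apply: ler_sum => z _; rewrite /b.
    by case: ifP; rewrite ?mul0r.
  have ku : 0 <= k / sg u by rewrite divr_ge0// ltW.
  have := sum_weight_sector hw rho_gt0 q_rho_lt1 sg_gt0 sg_parent u us.
  move=> /(ler_wpM2l ku) /le_trans; apply.
  by rewrite mulrA divfK// gt_eqF.
have -> : 4 * k / (1 - q%:R * rho) + r ^+ N * (2 * \sum_(z <- s) C z * sg z) =
  2 * (2 * (k / (1 - q%:R * rho)) + r ^+ N * \sum_(z <- s) C z * sg z) by ring.
rewrite ler_pM2l//.
apply: (@le_trans _ _ (\sum_(z <- s)
    (\sum_(j < N) r ^+ j * (b z (iter j.+1 parent v) * sg z)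
     + r ^+ N * (C z * sg z)))).
  apply: ler_sum => z _.
  have := @increment_bound _ (b z) (ha z) (ab z) N v => /le_trans le1.
  have /le1 le2 : \sum_(j < N) r ^+ j * b z (iter j.+1 parent v) +
     r ^+ N * `|increment w (a z) (iter N parent v)| <=
     \sum_(j < N) r ^+ j * b z (iter j.+1 parent v) + r ^+ N * C z.
    by rewrite lerD2l ler_wpM2l ?exprn_ge0// (ltW (qV_gt0 R hq)).
  apply: le_trans (ler_wpM2r (ltW (sg_gt0 z)) le2) _.
  rewrite mulrDl mulr_suml -mulrA lerD2r; apply: ler_sum => j _.
  by rewrite mulrA.
rewrite big_split /= -mulr_sumr lerD2r exchange_big /=.
apply: (@le_trans _ _ (\sum_(j < N) r ^+ j * (k / (1 - q%:R * rho)))).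
  apply: ler_sum => j _; rewrite -mulr_sumr; apply: ler_wpM2l; last exact: bsum.
  by rewrite exprn_ge0// (ltW (qV_gt0 R hq)).
by rewrite -mulr_suml ler_wpM2r ?divr_ge0 ?(ltW qr)// sum_qVX_le2.
Qed.

End Estimates.

(** * The Bergman kernel *)

Lemma rsumN (R : realType) (T : choiceType) (g : T -> R) :
  rsum (fun x => - g x) = - rsum g.
Proof.
rewrite /rsum opprB; congr (_ - fine _).
by apply: eq_esum => x _; rewrite opprK.
Qed.

Section Kernel.
Variables (R : realType) (q : nat) (hq : (2 <= q)%N) (X : homogeneous_tree q).
Variables (w : set (nat -> X)) (hw : is_boundary_point w).
Variables (H : set X) (hH : is_horocycle w H).
Variables (alpha : R) (halpha : 1 < alpha).
Implicit Types (x y z u v c : X) (k : X -> R[i]).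
Local Notation sg := (sigma w H alpha).
Local Notation parent := (parent w).
Local Notation lev := (hindex w H).

Definition sigma_ratio : R := q%:R `^ (- alpha).

Lemma sigma_ratio_gt0 : 0 < sigma_ratio.
Proof. exact/powR_gt0/q_gt0. Qed.

Lemma q_sigma_ratio_lt1 : q%:R * sigma_ratio < 1.
Proof.
have q0 := q_gt0 R hq.
rewrite -{1}(powRr1 (ltW q0)) -powRD; last by rewrite (gt_eqF q0) implybT.
have le1 : q%:R `^ (1 - alpha) <= q%:R `^ 0 :> R.
  by apply: ler_powR; [rewrite ler1n; lia|rewrite subr_le0 ltW].
rewrite powRr0 in le1; rewrite lt_neqAle le1 andbT powR_eq1 !negb_or -leNgt.
by rewrite (ltW q0) pnatr_eq1 /= subr_eq0 (lt_eqF halpha) andbT; lia.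
Qed.

Lemma sigma_gt0 x : 0 < sg x.
Proof. exact/powR_gt0/q_gt0. Qed.

Lemma sigma_parent x : sg x = sigma_ratio * sg (parent x).
Proof.
rewrite /sigma -powRD; last by rewrite (gt_eqF (q_gt0 R hq)) implybT.
by congr powR; rewrite hindex_parent// intrB; lra.
Qed.

Lemma harmonic_part (P : {additive R[i] -> R}) k :
  (forall (t : R) (s : R[i]), P (t%:C * s) = t * P s) -> Defs.harmonic k ->
  real_harmonic w (fun x => P (k x)).
Proof.
move=> PZ hk x.
have -> : k (parent x) = (q.+1%:R)%:C * k x - \sum_(y <- children w x) k y.
  rewrite (hk x) (sum_adj hw) rmorph_nat mulrA divff ?pnatr_eq0// mul1r.
  by rewrite addrK.
by rewrite raddfB PZ raddf_sum subrK.
Qed.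

Lemma harmonic_real (a : X -> R) :
  real_harmonic w a -> Defs.harmonic (fun x => (a x)%:C).
Proof.
move=> ha x; rewrite (sum_adj hw) -raddf_sum -rmorphD -ha rmorphM rmorph_nat.
by rewrite mulrA mulVf ?pnatr_eq0// mul1r.
Qed.

Lemma normc_ge_parts (s : R[i]) :
  complex.Re s ^+ 2 <= Normc.normc s ^+ 2 /\
  complex.Im s ^+ 2 <= Normc.normc s ^+ 2.
Proof.
case: s => a b /=; rewrite sqr_sqrtr ?addr_ge0 ?sqr_ge0//.
by rewrite lerDl lerDr !sqr_ge0.
Qed.

Lemma normc_le_parts (s : R[i]) :
  Normc.normc s <= `|complex.Re s| + `|complex.Im s|.
Proof.
case: s => a b /=; rewrite -[leRHS]ger0_norm ?addr_ge0// -sqrtr_sqr ler_wsqrtr//.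
by rewrite sqrrD !real_normK ?num_real// -addrA lerD2l lerDr mulrn_wge0 ?mulr_ge0.
Qed.

Lemma sibling_potential_bergman c c' : parent c = parent c' ->
  bergman_space w H alpha (fun x => (sibling_potential R w lev c c' x)%:C).
Proof.
move=> cc'; split.
  apply: harmonic_real; apply: sibling_potential_harmonic => // x.
  exact: hindex_parent.
apply: (@le_lt_trans _ _ (sg (parent c) / (1 - q%:R * sigma_ratio))%:E).
  2: exact: ltry.
apply: esum_le => s us _.
apply: (@le_trans _ _ (\sum_(z <- s | `[< sector w (parent c) z >]) sg z)); last first.
  exact: (sum_weight_sector hw sigma_ratio_gt0 q_sigma_ratio_lt1 sigma_gt0
    sigma_parent).
rewrite [leRHS]big_mkcond /=; apply: ler_sum => z _.
rewrite expr0n addr0 sqr_sqrtr ?sqr_ge0//; case: asboolP => uz.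
  rewrite ler_piMl ?(ltW (sigma_gt0 _))// -real_normK ?num_real// exprn_ile1//.
  exact: sibling_potential_bound.
by rewrite sibling_potential_out// expr0n mul0r.
Qed.

(** The form in which the reproducing property is used, for a the real or the
    imaginary part of the kernel at z. The third clause is an inequality because
    the pairing is the value of the sibling potential at z for the real part,
    and 0 for the imaginary part. *)
Definition kernel_part z (a : X -> R) :=
  [/\ real_harmonic w a,
      (\esum_(x in [set: X]) (a x ^+ 2 * sg x)%:E < +oo)%E &
      forall c c', parent c = parent c' ->
        `|rsum (fun x => sibling_potential R w lev c c' x * a x * sg x)| <=
        `|sibling_potential R w lev c c' z| ].

Lemma reproduces_parts z k : reproduces w H alpha z k ->
  kernel_part z (fun x => complex.Re (k x)) /\
  kernel_part z (fun x => complex.Im (k x)).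
Proof.
move=> [[hk koo] kz].
have rep c c' : parent c = parent c' ->
    (sibling_potential R w lev c c' z)%:C =
    rsum (fun x => sibling_potential R w lev c c' x * complex.Re (k x) * sg x) +i*
    - rsum (fun x => sibling_potential R w lev c c' x * complex.Im (k x) * sg x).
  move=> /sibling_potential_bergman/kz ->; rewrite /bergman_inner /csum -rsumN.
  by congr (_ +i* _); congr rsum; apply/funext => x; case: (k x) => a b /=; ring.
split; split.
- by apply: (harmonic_part (P := @complex.Re R)) => // t [a b] /=; ring.
- apply: le_lt_trans koo; apply: le_esum => x _.
  by rewrite lee_fin ler_pM2r ?sigma_gt0//; case: (normc_ge_parts (k x)).
- by move=> c c' /rep [<-].
- by apply: (harmonic_part (P := @complex.Im R)) => // t [a b] /=; ring.
- apply: le_lt_trans koo; apply: le_esum => x _.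
  by rewrite lee_fin ler_pM2r ?sigma_gt0//; case: (normc_ge_parts (k x)).
- by move=> c c' /rep [_ /esym/eqP]; rewrite oppr_eq0 => /eqP ->; rewrite normr0.
Qed.

(** sibling_estimate gives the constant 1 / ((1 - 1 / q) * sigma_ratio), and
    1 - 1 / q is at least 1 / 2. *)
Lemma kernel_part_sibling z a c c' : kernel_part z a -> parent c' = parent c ->
  `|a c - a c'| <=
  if `[< sector w (parent c) z >] then 2 / sigma_ratio / sg (parent c) else 0.
Proof.
move=> [ha aoo az] c'c.
have k0 u : 0 < 2 / sigma_ratio / sg u by rewrite !divr_gt0 ?sigma_ratio_gt0 ?sigma_gt0.
have [->|cNc'] := eqVneq c c'.
  by rewrite subrr normr0; case: ifP => // _; exact/ltW/k0.
have := sibling_estimate hq hw (hindex_parent hw hH) sigma_ratio_gt0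
  q_sigma_ratio_lt1 sigma_gt0 sigma_parent ha aoo (esym c'c) cNc'.
move=> /le_trans /(_ (az _ _ (esym c'c))).
have r2 := qV_le R hq; have r0 := sigma_gt0 c.
have f0 : 0 < (1 - (q%:R^-1 : R)) * sg c by rewrite mulr_gt0//; lra.
case: asboolP => [_|cz]; last first.
  by rewrite sibling_potential_out// ?normr0 ?pmulr_rle0.
move=> /le_trans /(_ (sibling_potential_bound R hq w lev c c' z)) le1.
rewrite -mulrA -invfM -sigma_parent ler_pdivlMr// mulrC.
have := normr_ge0 (a c - a c'); nra.
Qed.

(** Square summability bounds a ^ 2 by a multiple of 1 / sigma, and sigma
    increases towards the boundary point. *)
Lemma kernel_part_bounded z a v : kernel_part z a ->
  exists C, forall N, `|increment w a (iter N parent v)| <= C.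
Proof.
move=> [_ aoo _]; set E := \esum_(x in _) _ in aoo.
have Efin : E \is a fin_num.
  by apply: esum_fin_num => // x; rewrite mulr_ge0 ?sqr_ge0// ltW ?sigma_gt0.
have E0 : 0 <= fine E.
  apply: fine_ge0; apply: esum_ge0 => x _.
  by rewrite lee_fin mulr_ge0 ?sqr_ge0// ltW ?sigma_gt0.
have aE x : a x ^+ 2 * sg x <= fine E.
  rewrite -lee_fin fineK//.
  have := @esum_ge_seq _ _ [set: X] (fun x => a x ^+ 2 * sg x) [:: x].
  by rewrite big_seq1; apply.
have rho1 : sigma_ratio <= 1.
  by have := q_sigma_ratio_lt1; have := sigma_ratio_gt0; have : 1 <= q%:R :> R;
    [rewrite ler1n; lia|nra].
have bd N : `|a (iter N parent v)| <= 1 + fine E / sg v.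
  set u := iter N parent v.
  have vu : sg v <= sg u.
    rewrite (weight_iter sigma_parent N v) ler_piMl ?(ltW (sigma_gt0 _))//.
    by rewrite exprn_ile1 ?(ltW sigma_ratio_gt0).
  have le1 : a u ^+ 2 <= fine E / sg v.
    rewrite ler_pdivlMr ?sigma_gt0//; apply: le_trans (aE u).
    by rewrite ler_wpM2l ?sqr_ge0.
  apply: le_trans (_ : _ <= 1 + a u ^+ 2) _; last by rewrite lerD2l.
  by rewrite -real_normK ?num_real//; have := sqr_ge0 (`|a u| - 1); nra.
exists (2 * (1 + fine E / sg v)) => N.
apply: le_trans (ler_normB _ _) _; rewrite mulr_natl mulr2n lerD//.
exact: (bd N.+1).
Qed.

(** The kernel at z is a function that reproduces at z, or else the zero
    function, for which every clause is trivial. *)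
Lemma kernel_parts z :
  kernel_part z (fun x => complex.Re (bergman_kernel w H alpha z x)) /\
  kernel_part z (fun x => complex.Im (bergman_kernel w H alpha z x)).
Proof.
rewrite /bergman_kernel; case: xgetP => [k _ /reproduces_parts//|_].
have E (f : X -> R) : esum [set: X] (fun x => (0 ^+ 2 * f x)%:E) = 0%E.
  by apply: esum1 => x _; rewrite expr0n mul0r.
have z0 : kernel_part z (fun=> 0).
  split; [|by rewrite E ltry|].
    by move=> x; rewrite big1// mulr0 addr0.
  move=> c c' _; rewrite (_ : rsum _ = 0) ?normr0//.
  by rewrite /rsum !esum1 ?subrr// => x _; rewrite mulr0 mul0r ?oppr0 maxxx.
by split.
Qed.

Lemma kernel_sum_le v x y : sector w v x -> sector w v y ->
  (\esum_(z in ~` sector w v)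
     (Normc.normc (bergman_kernel w H alpha z x - bergman_kernel w H alpha z y)
      * sg z)%:E <= (2 * (4 * (2 / sigma_ratio) / (1 - q%:R * sigma_ratio)))%:E)%E.
Proof.
move=> vx vy; apply: esum_le => s us sv.
set K := bergman_kernel w H alpha.
have le1 (a : X -> X -> R) : (forall z, kernel_part z (a z)) ->
    \sum_(z <- s) `|a z x - a z y| * sg z <=
    4 * (2 / sigma_ratio) / (1 - q%:R * sigma_ratio).
  move=> ka; apply: (sum_oscillation_le hq hw sigma_ratio_gt0 q_sigma_ratio_lt1
    sigma_gt0 sigma_parent _ _ _ _ vx vy us sv).
  - by rewrite divr_ge0 ?(ltW sigma_ratio_gt0).
  - by move=> z; have [] := ka z.
  - by move=> z c c'; exact: kernel_part_sibling.
  - by move=> z; exact: kernel_part_bounded (ka z).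
have := le1 _ (fun z => (kernel_parts z).1).
have := le1 _ (fun z => (kernel_parts z).2).
rewrite -/K => leI leR.
rewrite mulr_natl mulr2n; apply: le_trans (lerD leR leI); rewrite -big_split /=.
apply: ler_sum => z _; rewrite -mulrDl ler_pM2r ?sigma_gt0//.
apply: le_trans (normc_le_parts _) _.
by case: (K z x) => a b; case: (K z y).
Qed.

End Kernel.

Theorem proposition24 (R : realType) (q : nat) (hq : (2 <= q)%N)
    (X : homogeneous_tree q)
    (w : set (nat -> X)) (hw : is_boundary_point w)
    (H : set X) (hH : is_horocycle w H)
    (alpha : R) (halpha : 1 < alpha) :
  (ereal_sup (range (fun v : X =>
     ereal_sup
       [set \esum_(z in ~` sector w v)
              (Normc.normc (bergman_kernel w H alpha z x
                            - bergman_kernel w H alpha z y)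
               * sigma w H alpha z)%:E
       | x in sector w v & y in sector w v])) < +oo)%E.
Proof.
pose rho := sigma_ratio q alpha.
apply: (@le_lt_trans _ _ (2 * (4 * (2 / rho) / (1 - q%:R * rho)))%:E).
  apply: ge_ereal_sup => _ [v _ <-]; apply: ge_ereal_sup => _ [x vx [y vy <-]].
  exact: kernel_sum_le.
exact: ltry.
Qed.
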